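(* Assume $\mathcal N\ge Q_B=mQ_A+Q_b$. Let $\mathbf B=[\hat{\mathbf A}^1,\dots,\hat{\mathbf A}^{Q_A},\hat{\mathbf b}^1,\dots,\hat{\mathbf b}^{Q_b}]\in\mathbb R^{\mathcal N\times Q_B}$, and let $\mathbf Q\mathbf R=\mathbf B\mathbf P$ be an economy QR factorization of $\mathbf B$ with column pivoting, where $\mathbf Q\in\mathbb R^{\mathcal N\times s}$ has orthonormal columns, $\mathbf R\in\mathbb R^{s\times Q_B}$ is upper triangular and $\mathbf P\in\mathbb R^{Q_B\times Q_B}$ is a permutation matrix. Put $\mathbf Y^q=\mathbf Q^T\hat{\mathbf A}^q\in\mathbb R^{s\times m}$ for $q=1,\dots,Q_A$. For $\mu\in\mathcal P$ put $\mathbf Y_\mu=\sum_{q=1}^{Q_A}\theta^A_q(\mu)\mathbf Y^q\in\mathbb R^{s\times m}$ and let $\mathbf Y_\mu=\tilde{\mathbf Q}_\mu\mathbf R_\mu$ be an economy QR factorization, where $\tilde{\mathbf Q}_\mu\in\mathbb R^{s\times m}$ has orthonormal columns and $\mathbf R_\mu\in\mathbb R^{m\times m}$ is upper triangular. Then for every $\mu\in\mathcal P$: (i) $\mathbf Q$ has rank $s$, with $m\le s\le Q_B$; (ii) $\mathbf Y_\mu$ has full rank; (iii) the economy QR factorization of $\hat{\mathbf A}_\mu$ is $\hat{\mathbf A}_\mu=\widehat{\mathbf Q}_\mu\mathbf R_\mu$ with $\widehat{\mathbf Q}_\mu=\mathbf Q\tilde{\mathbf Q}_\mu\in\mathbb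 R^{\mathcal N\times m}$ satisfying $\widehat{\mathbf Q}_\mu^T\widehat{\mathbf Q}_\mu=\mathbf I_{m\times m}$ and $\mathbf R_\mu$ upper triangular; (iv) as a consequence, the solution $\mathbf c_{RB}^m(\mu)=\operatorname{argmin}_{\mathbf c\in\mathbb R^m}\|\hat{\mathbf A}_\mu\mathbf c-\hat{\mathbf b}_\mu\|_{\ell_2}$ is $$\mathbf c_{RB}^m(\mu)=\mathbf R_\mu^{-1}(\mathbf Q\tilde{\mathbf Q}_\mu)^T\Big(\sum_{q=1}^{Q_b}\theta_q^b(\mu)\hat{\mathbf b}^q\Big)=\mathbf R_\mu^{-1}\tilde{\mathbf Q}_\mu^T\Big(\sum_{q=1}^{Q_b}\theta_q^b(\mu)(\mathbf Q^T\hat{\mathbf b}^q)\Big).$$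
   Context: Full order model. $\mathcal P\subset\mathbb R^d$ is a compact parameter set. The spatial domain $\Omega_{\mathbf x}=[x_L,x_R]\times[y_L,y_R]$ is partitioned into a Cartesian mesh $\mathcal T_h$; $\hat U_h^K=\{u: u|_T\in Q^K(T)\ \forall T\in\mathcal T_h\}$ ($Q^K(T)$: polynomials of degree at most $K$ in each spatial variable), with a basis $\{\phi_k\}_{k=1}^{N_{\mathbf x}}$, each $\phi_k$ supported in a single element. $\{\mathbf v_j\}_{j=1}^{N_{\mathbf v}}$ are angular quadrature points on the unit sphere with positive weights $\omega_j$ satisfying $\sum_j\omega_j=1$. Set $\mathcal N=N_{\mathbf x}N_{\mathbf v}$. $\mathbf M\in\mathbb R^{N_{\mathbf x}\times N_{\mathbf x}}$ is the mass matrix $(\mathbf M)_{kl}=\int_{\Omega_{\mathbf x}}\phi_k\phi_l\,d\mathbf x$. The full order system for the parametric radiative transfer equation is $\mathbf A_\mu\mathbf f_\mu=\mathbf b_\mu$, with $\mathbf A_\mu=\mathbf D+\mathbf\Sigma_{s,\mu}+\mathbf\Sigma_{a,\mu}\in\mathbb R^{\mathcal N\times\mathcal N}$, $\mathbf b_\mu\in\mathbb R^{\mathcal N}$. Here $\mathbf D=\mathrm{diag}(\mathbf D_1,\dots,\mathbf D_{N_{\mathbf v}})$ is the ($\mu$-independent) upwind discontinuous Galerkin discretization of the transport operators $\mathbf v_j\cdot\nabla_{\mathbf x}$ on $\hat U_h^K$; $\mathbf\Sigma_{a,\mu}=\mathbf I_{N_{\mathbf v}}\otimes\hat{\mathbf\Sigma}_{a,\mu}$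 and $\mathbf\Sigma_{s,\mu}=(\mathbf I_{N_{\mathbf v}}-[1,\dots,1]^T[\omega_1,\dots,\omega_{N_{\mathbf v}}])\otimes\hat{\mathbf\Sigma}_{s,\mu}$, with $(\hat{\mathbf\Sigma}_{a,\mu})_{kl}=\int\sigma_a(\mathbf x;\mu)\phi_k\phi_l\,d\mathbf x$, $(\hat{\mathbf\Sigma}_{s,\mu})_{kl}=\int\sigma_s(\mathbf x;\mu)\phi_k\phi_l\,d\mathbf x$ ($\sigma_a,\sigma_s\ge0$ absorption and scattering cross sections); $\mathbf b_\mu$ collects the source and inflow boundary data. Affine parameter dependence is assumed: $\mathbf\Sigma_{s,\mu}=\sum_{q=1}^{Q_s}\theta_q^s(\mu)\mathbf\Sigma_s^q$, $\mathbf\Sigma_{a,\mu}=\sum_{q=1}^{Q_a}\theta_q^a(\mu)\mathbf\Sigma_a^q$, $\mathbf b_\mu=\sum_{q=1}^{Q_b}\theta_q^b(\mu)\mathbf b^q$, where the matrices $\mathbf\Sigma_s^q,\mathbf\Sigma_a^q\in\mathbb R^{\mathcal N\times\mathcal N}$ and vectors $\mathbf b^q\in\mathbb R^{\mathcal N}$ are independent of $\mu$ and the coefficients are continuous real functions on $\mathcal P$. Reduced quantities. $\mathcal U_{RB}^m\in\mathbb R^{\mathcal N\times m}$, $m<\mathcal N$, has orthonormal columns (a basis of the span of the full order solution vectors $\mathbf f_{\mu_1},\dots,\mathbf f_{\mu_m}$ at $m$ selected parameters, assumed linearly independent). $\mathcal M_h=\mathrm{diag}(\omega_1\mathbf M^{-1},\dots,\omega_{N_{\mathbf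 v}}\mathbf M^{-1})$ is symmetric positive definite, with Cholesky factorization $\mathcal M_h=\mathcal G^T\mathcal G$, $\mathcal G$ upper triangular. With $Q_A=1+Q_s+Q_a$, the parameter-independent matrices $\hat{\mathbf A}^1,\dots,\hat{\mathbf A}^{Q_A}\in\mathbb R^{\mathcal N\times m}$ are $\mathcal G\mathbf D\,\mathcal U_{RB}^m$, $\{\mathcal G\mathbf\Sigma_s^q\,\mathcal U_{RB}^m\}_{q=1}^{Q_s}$, $\{\mathcal G\mathbf\Sigma_a^q\,\mathcal U_{RB}^m\}_{q=1}^{Q_a}$, with respective coefficients $\theta^A_q(\mu)$ equal to $1$, $\theta_q^s(\mu)$, $\theta_q^a(\mu)$; $\hat{\mathbf b}^q=\mathcal G\mathbf b^q\in\mathbb R^{\mathcal N}$. Thus $\hat{\mathbf A}_\mu=\mathcal G\mathbf A_\mu\,\mathcal U_{RB}^m=\sum_{q=1}^{Q_A}\theta_q^A(\mu)\hat{\mathbf A}^q$ and $\hat{\mathbf b}_\mu=\mathcal G\mathbf b_\mu=\sum_{q=1}^{Q_b}\theta_q^b(\mu)\hat{\mathbf b}^q$. Standing assumption: $\mathbf A_\mu$ is invertible for each $\mu\in\mathcal P$, so $\hat{\mathbf A}_\mu$ has full column rank $m$. ''Economy QR factorization'' of a matrix means a factorization as a matrix with orthonormal columns times an upper triangular (or upper trapezoidal) matrix; in the pivoted factorization of $\mathbf B$, the number of columns $s$ of $\mathbf Q$ is at most $Q_B$. *)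

(* Defs.v *)
(* MathComp / MathComp-Analysis development over an abstract realType. *)
From HB Require Import structures.
From mathcomp Require Import all_boot all_order all_algebra.
From mathcomp Require Import all_classical all_reals all_analysis.
From mathcomp Require Import mxtens.

Set Implicit Arguments.
Unset Strict Implicit.
Unset Printing Implicit Defensive.

Import Order.TTheory GRing.Theory Num.Theory.
Import numFieldNormedType.Exports.

Local Open Scope classical_set_scope.
Local Open Scope ring_scope.

(* The analysis library norms matrices by the maximum of their entries, hence
   this separate Euclidean norm. *)
Definition l2norm (R : realType) (n : nat) (x : 'cV[R]_n) : R :=
  Num.sqrt (\sum_(i < n) x i 0 ^+ 2).

Definition is_argmin (R : realType) (n : nat) (F : 'cV[R]_n -> R)
    (c : 'cV[R]_n) : Prop :=
  forall c' : 'cV[R]_n, F c <= F c'.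

(* is_trig_mx is lower triangularity; for a wide or tall A the condition below
   is the upper trapezoidal one (A i j = 0 for j < i). *)
Definition upper_trig (R : realType) (m n : nat) (A : 'M[R]_(m, n)) : bool :=
  is_trig_mx A^T.

Definition orthonormal_cols (R : realType) (m n : nat) (A : 'M[R]_(m, n)) :
    Prop :=
  A^T *m A = 1%:M.

Definition economy_QR (R : realType) (m s n : nat) (A : 'M[R]_(m, n))
    (Q : 'M[R]_(m, s)) (T : 'M[R]_(s, n)) : Prop :=
  [/\ orthonormal_cols Q, upper_trig T & Q *m T = A].

(* Q may have fewer columns than B (rank-revealing truncation), never more. *)
Definition pivoted_economy_QR (R : realType) (m s n : nat) (B : 'M[R]_(m, n))
    (Q : 'M[R]_(m, s)) (T : 'M[R]_(s, n)) (P : 'M[R]_n) : Prop :=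
  [/\ is_perm_mx P, economy_QR (B *m P) Q T & (s <= n)%N].

Definition cholesky (R : realType) (n : nat) (A G : 'M[R]_n) : Prop :=
  [/\ upper_trig G, (forall i : 'I_n, 0 < G i i) & A = G^T *m G].

Definition blockdiag (R : realType) (n p : nat) (D : 'I_n -> 'M[R]_p) :
    'M[R]_(n * p) :=
  \sum_(j < n) (delta_mx j j : 'M[R]_n) *t D j.

(* [A^0, ..., A^(n-1)]: column i of A q is column q * m + i. *)
Definition hcat (R : realType) (N m n : nat) (A : 'I_n -> 'M[R]_(N, m)) :
    'M[R]_(N, n * m) :=
  \matrix_(k, c) A (mxtens_unindex c).1 k (mxtens_unindex c).2.

Definition cols_mx (R : realType) (N n : nat) (b : 'I_n -> 'cV[R]_N) :
    'M[R]_(N, n) :=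
  \matrix_(k, q) b q k 0.

Definition cat3 (T : Type) (p q : nat) (x : T) (f : 'I_p -> T) (g : 'I_q -> T)
    (k : 'I_(1 + p + q)) : T :=
  match fintype.split k with
  | inl k' => match fintype.split k' with inl _ => x | inr i => f i end
  | inr j => g j
  end.

(* A Cartesian mesh is a pair of strictly increasing grids; the node lists omit
   the left endpoints xL and yL, as itv_partition does. *)
Record cartesian_mesh (R : realType) (xL xR yL yR : R) := CartesianMesh {
  xnodes : seq R;
  ynodes : seq R;
  xnodesP : itv_partition xL xR xnodes;
  ynodesP : itv_partition yL yR ynodes
}.

Section DiscontinuousGalerkin.
Context {R : realType} {xL xR yL yR : R}.
Variables (T : cartesian_mesh xL xR yL yR) (K : nat).

Definition cell : Type := ('I_(size (xnodes T)) * 'I_(size (ynodes T)))%type.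

Definition xnode (i : nat) : R := nth xR (xL :: xnodes T) i.
Definition ynode (j : nat) : R := nth yR (yL :: ynodes T) j.

Definition cell_set (c : cell) : set (R * R) :=
  `[xnode c.1, xnode c.1.+1] `*` `[ynode c.2, ynode c.2.+1].

(* An element of the broken space assigns to every cell a polynomial of degree
   at most K in each variable, given by its matrix of monomial coefficients.
   Being cellwise, it has well-defined one-sided traces on every edge. *)
Definition dgspace : Type :=
  {ffun 'I_(size (xnodes T)) * 'I_(size (ynodes T)) -> 'M[R]_K.+1}.

Definition qeval (p : 'M[R]_K.+1) (x y : R) : R :=
  \sum_(a < K.+1) \sum_(b < K.+1) p a b * x ^+ a * y ^+ b.

Definition lebesgue2 := (@lebesgue_measure R \x @lebesgue_measure R)%E.

(* The integral over the domain of sigma * u * w; the traces on cell edges,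
   where u and w are two-valued, do not contribute. *)
Definition weighted_ip (sigma : R * R -> R) (u w : dgspace) : R :=
  \sum_(c : cell) \int[lebesgue2]_(z in cell_set c)
    (sigma z * qeval (u c) z.1 z.2 * qeval (w c) z.1 z.2).

(* The polynomial on cell (i, j), extended by 0 outside the mesh: the exterior
   trace at inflow boundary edges is data and belongs to the right-hand side. *)
Definition cellpoly (u : dgspace) (i j : nat) : 'M[R]_K.+1 :=
  match insub i, insub j with
  | Some i', Some j' => u (i', j')
  | _, _ => 0
  end.

(* Upwind trace at height y on the vertical edge x = xnode f of row j, which
   separates the cells (f - 1, j) and (f, j). *)
Definition upwind_x (vx : R) (u : dgspace) (f j : nat) (y : R) : R :=
  qeval (if 0 <= vx then (if f is i.+1 then cellpoly u i j else 0)
         else cellpoly u f j) (xnode f) y.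

Definition upwind_y (vy : R) (u : dgspace) (i f : nat) (x : R) : R :=
  qeval (if 0 <= vy then (if f is j.+1 then cellpoly u i j else 0)
         else cellpoly u i f) x (ynode f).

(* Upwind DG form of v . grad_x, trial function u and test function w:
   sum over cells C of
     int_(boundary of C) (v . n) u^upwind w - int_C u (v . grad w). *)
Definition upwind_form (vx vy : R) (u w : dgspace) : R :=
  \sum_(c : cell)
    (vx * (\int[lebesgue_measure]_(y in `[ynode c.2, ynode c.2.+1])
         (upwind_x vx u c.1.+1 c.2 y * qeval (w c) (xnode c.1.+1) y
          - upwind_x vx u c.1 c.2 y * qeval (w c) (xnode c.1) y))
     + vy * (\int[lebesgue_measure]_(x in `[xnode c.1, xnode c.1.+1])
         (upwind_y vy u c.1 c.2.+1 x * qeval (w c) x (ynode c.2.+1)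
          - upwind_y vy u c.1 c.2 x * qeval (w c) x (ynode c.2)))
     - (\int[lebesgue2]_(z in cell_set c)
         (qeval (u c) z.1 z.2 *
          (vx * derive1 (fun t : R => qeval (w c) t z.2) z.1 +
           vy * derive1 (fun t : R => qeval (w c) z.1 t) z.2)))).

Definition single_cell_support (u : dgspace) : Prop :=
  exists c : cell, forall c' : cell, c' != c -> u c' = 0.

Variables (Nx Nv : nat) (phi : Nx.-tuple dgspace).

Definition weighted_mass (sigma : R * R -> R) : 'M[R]_Nx :=
  \matrix_(k, l) weighted_ip sigma (tnth phi k) (tnth phi l).

Definition mass_mx : 'M[R]_Nx := weighted_mass (fun=> 1).

(* Directions are points of the unit sphere of R^3; as the problem does not
   depend on the third space variable, v . grad_x involves only the first two
   components. Row index: test function; column index: trial function. *)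
Definition transport_mx (v : 'I_Nv -> 'cV[R]_3) : 'M[R]_(Nv * Nx) :=
  blockdiag (fun j : 'I_Nv =>
    \matrix_(k < Nx, l < Nx)
      upwind_form (v j 0 0) (v j 1 0) (tnth phi l) (tnth phi k)).

Definition absorption_mx (sigma_a : R * R -> R) : 'M[R]_(Nv * Nx) :=
  (1%:M : 'M[R]_Nv) *t weighted_mass sigma_a.

Definition scattering_mx (omega : 'I_Nv -> R) (sigma_s : R * R -> R) :
    'M[R]_(Nv * Nx) :=
  (1%:M - const_mx 1 *m \row_(j < Nv) omega j : 'M[R]_Nv)
    *t weighted_mass sigma_s.

Definition weighted_inv_mass (omega : 'I_Nv -> R) : 'M[R]_(Nv * Nx) :=
  blockdiag (fun j : 'I_Nv => omega j *: invmx mass_mx).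

End DiscontinuousGalerkin.

(* Main.v *)
Require Import Defs.
From HB Require Import structures.
From mathcomp Require Import all_boot all_order all_algebra.
From mathcomp Require Import all_classical all_reals all_analysis.
From mathcomp Require Import mxtens.

Set Implicit Arguments.
Unset Strict Implicit.
Unset Printing Implicit Defensive.

Import Order.TTheory GRing.Theory Num.Theory.
Import numFieldNormedType.Exports.

Local Open Scope classical_set_scope.
Local Open Scope ring_scope.

(** The range of [Q] contains the column space of [B], hence that of every block
[Ahat_q].  So [Q Q^T], the orthogonal projector onto the
range of [Q], fixes these blocks ([pivoted_QR_proj], [mul_hcat]), and by
linearity it fixes [Ahat mu]: one has [Ahat mu = Q (Y mu)] with
[Y mu = Q^T (Ahat mu)].

This identity gives everything else.  A QR factorization of [Y mu] multiplied on
the left by [Q] is one of [Ahat mu], because a product of matrices with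
orthonormal columns has orthonormal columns ([economy_QR_mull]).  The Cholesky
factor [G] and [A mu] are invertible and [U] has orthonormal columns, so
[Ahat mu] has rank [m]; this rank passes to its right factors [Y mu] and [Rm mu]
in turn, and it forces [m <= s].  With [Rm mu] invertible, the residual of the
least-squares problem splits by Pythagoras into a constant part and the
part [Ahat mu (c - c0)], which vanishes only at [c = c0] ([least_squares_QR]). *)

(** * Orthonormal columns and triangular matrices *)

Lemma rank_orthonormal_cols (R : realType) (m n : nat) (Q : 'M[R]_(m, n)) :
  orthonormal_cols Q -> \rank Q = n.
Proof.
move=> QQ; apply/eqP; rewrite eqn_leq rank_leq_col /=.
by rewrite -{1}(mxrank1 R n) -QQ mxrankM_maxr.
Qed.

Lemma orthonormal_colsM (R : realType) (m n p : nat)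
    (Q : 'M[R]_(m, n)) (V : 'M[R]_(n, p)) :
  orthonormal_cols Q -> orthonormal_cols V -> orthonormal_cols (Q *m V).
Proof.
rewrite /orthonormal_cols => QQ VV.
by rewrite trmx_mul -mulmxA (mulmxA _ Q) QQ mul1mx.
Qed.

Lemma economy_QR_mull (R : realType) (m n p q : nat) (Q : 'M[R]_(m, n))
    (A : 'M[R]_(n, q)) (V : 'M[R]_(n, p)) (T : 'M[R]_(p, q)) :
  orthonormal_cols Q -> economy_QR A V T -> economy_QR (Q *m A) (Q *m V) T.
Proof.
move=> QQ [VV Tu <-]; split=> //; first exact: orthonormal_colsM.
by rewrite mulmxA.
Qed.

Lemma cholesky_unitmx (R : realType) (n : nat) (A G : 'M[R]_n) :
  cholesky A G -> G \in unitmx.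
Proof.
move=> [Gu Gd _]; rewrite unitmxE -det_tr (det_trig Gu) unitfE.
by apply/prodf_neq0 => i _; rewrite mxE gt_eqF.
Qed.

(** The pivoting permutation is invertible, so it does not change the column
space: all the columns of [B] lie in the range of [Q]. *)
Lemma pivoted_QR_proj (R : realType) (m s n : nat) (B : 'M[R]_(m, n))
    (Q : 'M[R]_(m, s)) (T : 'M[R]_(s, n)) (P : 'M[R]_n) :
  pivoted_economy_QR B Q T P -> Q *m Q^T *m B = B.
Proof.
move=> [/is_perm_mxP[p ->] [QQ _ QT] _].
have -> : B = Q *m (T *m invmx (perm_mx p)).
  by rewrite mulmxA QT mulmxK // unitmx_perm.
by rewrite mulmxA -(mulmxA Q) QQ mulmx1.
Qed.

(** * Concatenated blocks and affine sums *)

Lemma mul_hcat (R : realType) (M N m n : nat) (E : 'M[R]_(M, N))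
    (A : 'I_n -> 'M[R]_(N, m)) :
  E *m hcat A = hcat (fun q => E *m A q).
Proof.
by apply/matrixP=> i c; rewrite !mxE; apply: eq_bigr => k _; rewrite mxE.
Qed.

Lemma hcat_inj (R : realType) (N m n : nat) (A A' : 'I_n -> 'M[R]_(N, m)) :
  hcat A = hcat A' -> A =1 A'.
Proof.
move=> /matrixP AA' q; apply/matrixP=> i j.
by have := AA' i (mxtens_index (q, j)); rewrite !mxE mxtens_indexK.
Qed.

(** For [F] the scaling [fun a X => a *: X], this recombines the coefficients
and the blocks, each stored as a three-part list, into the affine expansion of
the system matrix. *)
Lemma sum_cat3 (V : nmodType) (S T : Type) (F : S -> T -> V) (p q : nat)
    (x : S) (f : 'I_p -> S) (g : 'I_q -> S)
    (y : T) (h : 'I_p -> T) (k : 'I_q -> T) :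
  \sum_(i < 1 + p + q) F (cat3 x f g i) (cat3 y h k i)
  = F x y + \sum_(i < p) F (f i) (h i) + \sum_(i < q) F (g i) (k i).
Proof.
rewrite /cat3 !big_split_ord big_ord1 /=; congr (_ + _ + _).
- by rewrite !(unsplitK (inl _)).
- by apply: eq_bigr => i _; rewrite (unsplitK (inl _)) (unsplitK (inr _)).
- by apply: eq_bigr => i _; rewrite (unsplitK (inr _)).
Qed.

(** * Least squares *)

Lemma l2normE (R : realType) (n : nat) (x : 'cV[R]_n) :
  l2norm x = Num.sqrt ((x^T *m x) 0 0).
Proof.
by rewrite /l2norm mxE; congr Num.sqrt; apply: eq_bigr => i _; rewrite mxE expr2.
Qed.

Lemma tr_mul_ge0 (R : realType) (n : nat) (x : 'cV[R]_n) :
  0 <= (x^T *m x) 0 0.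
Proof. by rewrite mxE sumr_ge0 // => i _; rewrite mxE -expr2 sqr_ge0. Qed.

Lemma tr_mul_le0 (R : realType) (n : nat) (x : 'cV[R]_n) :
  (x^T *m x) 0 0 <= 0 -> x = 0.
Proof.
move=> x_le0; have /eqP : (x^T *m x) 0 0 = 0.
  by apply/eqP; rewrite eq_le x_le0 tr_mul_ge0.
rewrite mxE psumr_eq0 => [/allP x0|i _]; last by rewrite mxE -expr2 sqr_ge0.
apply/colP=> i; have := x0 i (mem_index_enum i).
by rewrite !mxE -expr2 sqrf_eq0 => /eqP.
Qed.

Lemma tr_mulD_orth (R : realType) (n : nat) (x y : 'cV[R]_n) :
  x^T *m y = 0 ->
  ((x + y)^T *m (x + y)) 0 0 = (x^T *m x) 0 0 + (y^T *m y) 0 0.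
Proof.
move=> xy0; have yx0 : y^T *m x = 0 by rewrite -[x]trmxK -trmx_mul xy0 trmx0.
rewrite [(x + y)^T]linearD /= mulmxDl !mulmxDr xy0 yx0 addr0 add0r.
by rewrite mxE.
Qed.

(** The residual at [c0 = T^-1 Q^T b] is orthogonal to the range of [A]; so the
squared residual at [c] is a constant plus the squared norm of
[A (c - c0) = Q T (c - c0)], which is zero only when [c = c0]. *)
Lemma least_squares_QR (R : realType) (m n : nat) (A Q : 'M[R]_(m, n))
    (T : 'M[R]_n) (b : 'cV[R]_m) (c : 'cV[R]_n) :
  economy_QR A Q T -> T \in unitmx ->
  is_argmin (fun c' => l2norm (A *m c' - b)) c
  <-> c = invmx T *m Q^T *m b.
Proof.
move=> [QQ _ <-] Tu; set c0 := invmx T *m _ *m b.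
have orth : Q^T *m (Q *m T *m c0 - b) = 0.
  have -> : Q *m T *m c0 = Q *m (Q^T *m b) by rewrite /c0 -!mulmxA mulKVmx.
  by rewrite mulmxBr (mulmxA _ Q) QQ mul1mx subrr.
have split_res c' : let z := T *m (c' - c0) in
    l2norm (Q *m T *m c' - b) =
    Num.sqrt ((z^T *m z) 0 0
              + ((Q *m T *m c0 - b)^T *m (Q *m T *m c0 - b)) 0 0).
  move=> z; have -> : Q *m T *m c' - b = Q *m z + (Q *m T *m c0 - b).
    by rewrite /z !mulmxBr !mulmxA addrA subrK.
  have Qz : (Q *m z)^T *m (Q *m z) = z^T *m z.
    by rewrite trmx_mul -mulmxA (mulmxA _ Q) QQ mul1mx.
  rewrite l2normE tr_mulD_orth ?Qz //.
  by rewrite trmx_mul -(mulmxA _ Q^T) orth mulmx0.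
split=> [/(_ c0)|-> c'].
  rewrite (split_res c) l2normE.
  rewrite ler_sqrt ?addr_ge0 ?tr_mul_ge0 // gerDr => /tr_mul_le0 Tc0.
  by apply/eqP; rewrite -subr_eq0 -(mulKmx Tu (c - c0)) Tc0 mulmx0.
rewrite (split_res c') l2normE.
by rewrite ler_sqrt ?addr_ge0 ?tr_mul_ge0 // lerDr tr_mul_ge0.
Qed.

(** * The reduced system *)

Theorem theorem1 (R : realType)
  (* parameter set *)
  (d : nat) (Par : set 'rV[R]_d) (Par_compact : compact Par)
  (* mesh, broken polynomial space, basis *)
  (xL xR yL yR : R) (xLR : xL < xR) (yLR : yL < yR)
  (T : cartesian_mesh xL xR yL yR) (K Nx : nat)
  (phi : Nx.-tuple (dgspace T K))
  (phi_basis : basis_of fullv phi)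
  (phi_supp : forall k : 'I_Nx, single_cell_support (tnth phi k))
  (* angular quadrature *)
  (Nv : nat) (v : 'I_Nv -> 'cV[R]_3) (omega : 'I_Nv -> R)
  (v_sphere : forall j : 'I_Nv, l2norm (v j) = 1)
  (omega_gt0 : forall j : 'I_Nv, 0 < omega j)
  (omega_sum1 : \sum_(j < Nv) omega j = 1)
  (* cross sections *)
  (sigma_a sigma_s : 'rV[R]_d -> R * R -> R)
  (sigma_a_ge0 : forall mu : 'rV[R]_d, Par mu ->
     forall z : R * R, (`[xL, xR] `*` `[yL, yR]) z -> 0 <= sigma_a mu z)
  (sigma_s_ge0 : forall mu : 'rV[R]_d, Par mu ->
     forall z : R * R, (`[xL, xR] `*` `[yL, yR]) z -> 0 <= sigma_s mu z)
  (sigma_a_int : forall mu : 'rV[R]_d, Par mu ->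
     lebesgue2.-integrable (`[xL, xR] `*` `[yL, yR]) (EFin \o sigma_a mu))
  (sigma_s_int : forall mu : 'rV[R]_d, Par mu ->
     lebesgue2.-integrable (`[xL, xR] `*` `[yL, yR]) (EFin \o sigma_s mu))
  (* source and inflow boundary data *)
  (b : 'rV[R]_d -> 'cV[R]_(Nv * Nx))
  (* affine parameter dependence *)
  (Qs Qa Qb : nat)
  (theta_s : 'I_Qs -> 'rV[R]_d -> R) (Sigma_s : 'I_Qs -> 'M[R]_(Nv * Nx))
  (theta_a : 'I_Qa -> 'rV[R]_d -> R) (Sigma_a : 'I_Qa -> 'M[R]_(Nv * Nx))
  (theta_b : 'I_Qb -> 'rV[R]_d -> R) (bq : 'I_Qb -> 'cV[R]_(Nv * Nx))
  (theta_s_cont : forall q : 'I_Qs, {within Par, continuous (theta_s q)})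
  (theta_a_cont : forall q : 'I_Qa, {within Par, continuous (theta_a q)})
  (theta_b_cont : forall q : 'I_Qb, {within Par, continuous (theta_b q)})
  (affine_s : forall mu : 'rV[R]_d, Par mu ->
     scattering_mx phi omega (sigma_s mu)
     = \sum_(q < Qs) theta_s q mu *: Sigma_s q)
  (affine_a : forall mu : 'rV[R]_d, Par mu ->
     absorption_mx Nv phi (sigma_a mu)
     = \sum_(q < Qa) theta_a q mu *: Sigma_a q)
  (affine_b : forall mu : 'rV[R]_d, Par mu ->
     b mu = \sum_(q < Qb) theta_b q mu *: bq q) :
  let N := (Nv * Nx)%N in
  let D : 'M[R]_N := transport_mx phi v in
  let A (mu : 'rV[R]_d) : 'M[R]_N :=
    D + scattering_mx phi omega (sigma_s mu)
      + absorption_mx Nv phi (sigma_a mu) in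
  forall
  (A_unit : forall mu : 'rV[R]_d, Par mu -> A mu \in unitmx)
  (* full order solutions and reduced basis *)
  (f : 'rV[R]_d -> 'cV[R]_N)
  (f_sol : forall mu : 'rV[R]_d, Par mu -> A mu *m f mu = b mu)
  (m : nat) (m_lt_N : (m < N)%N)
  (mu_sel : 'I_m -> 'rV[R]_d)
  (mu_selP : forall i : 'I_m, Par (mu_sel i))
  (snap_free : row_free (cols_mx (fun i : 'I_m => f (mu_sel i)))^T)
  (U : 'M[R]_(N, m))
  (U_orth : orthonormal_cols U)
  (U_span : (U^T == (cols_mx (fun i : 'I_m => f (mu_sel i)))^T)%MS)
  (G : 'M[R]_N) (G_chol : cholesky (weighted_inv_mass phi omega) G),
  let QA := (1 + Qs + Qa)%N in
  let QB := (QA * m + Qb)%N in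
  let Ahat_q : 'I_QA -> 'M[R]_(N, m) :=
    cat3 (G *m D *m U) (fun q : 'I_Qs => G *m Sigma_s q *m U)
         (fun q : 'I_Qa => G *m Sigma_a q *m U) in
  let theta_A (q : 'I_QA) (mu : 'rV[R]_d) : R :=
    cat3 1 (fun q' : 'I_Qs => theta_s q' mu)
         (fun q' : 'I_Qa => theta_a q' mu) q in
  let bhat_q (q : 'I_Qb) : 'cV[R]_N := G *m bq q in
  let Ahat (mu : 'rV[R]_d) : 'M[R]_(N, m) := G *m A mu *m U in
  let bhat (mu : 'rV[R]_d) : 'cV[R]_N := G *m b mu in
  let B : 'M[R]_(N, QB) := row_mx (hcat Ahat_q) (cols_mx bhat_q) in
  forall
  (QB_le_N : (QB <= N)%N)
  (s : nat) (Q : 'M[R]_(N, s)) (Rp : 'M[R]_(s, QB)) (P : 'M[R]_QB)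
  (QR_B : pivoted_economy_QR B Q Rp P),
  let Yq (q : 'I_QA) : 'M[R]_(s, m) := Q^T *m Ahat_q q in
  let Y (mu : 'rV[R]_d) : 'M[R]_(s, m) :=
    \sum_(q < QA) theta_A q mu *: Yq q in
  forall
  (Qt : 'rV[R]_d -> 'M[R]_(s, m)) (Rm : 'rV[R]_d -> 'M[R]_m)
  (QR_Y : forall mu : 'rV[R]_d, Par mu -> economy_QR (Y mu) (Qt mu) (Rm mu))
  (mu : 'rV[R]_d) (mu_Par : Par mu),
  [/\ (* (i) *)
      [/\ \rank Q = s, (m <= s)%N & (s <= QB)%N],
      (* (ii) *)
      \rank (Y mu) = m,
      (* (iii) *)
      economy_QR (Ahat mu) (Q *m Qt mu) (Rm mu) &
      (* (iv) *)
      [/\ Rm mu \in unitmx,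
          forall c : 'cV[R]_m,
            is_argmin (fun c' : 'cV[R]_m => l2norm (Ahat mu *m c' - bhat mu)) c
            <-> c = invmx (Rm mu) *m (Q *m Qt mu)^T
                      *m (\sum_(q < Qb) theta_b q mu *: bhat_q q)
        & invmx (Rm mu) *m (Q *m Qt mu)^T
            *m (\sum_(q < Qb) theta_b q mu *: bhat_q q)
          = invmx (Rm mu) *m (Qt mu)^T
            *m (\sum_(q < Qb) theta_b q mu *: (Q^T *m bhat_q q))]].
Proof.
move=> N D A A_unit f f_sol m m_lt_N mu_sel mu_selP snap_free U U_orth U_span.
move=> G G_chol QA QB Ahat_q theta_A bhat_q Ahat bhat B QB_le_N s Q Rp P QR_B.
move=> Yq Y Qt Rm QR_Y mu mu_Par.
have [_ [Q_orth _ _] s_le_QB] := QR_B.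
have AhatE : Ahat mu = \sum_(q < QA) theta_A q mu *: Ahat_q q.
  rewrite (sum_cat3 (fun a X => a *: X)) scale1r /Ahat /A.
  rewrite affine_s // affine_a // !mulmxDr !mulmxDl.
  congr (_ + _ + _); rewrite mulmx_sumr mulmx_suml; apply: eq_bigr => q _;
    by rewrite -scalemxAr -scalemxAl.
have bhatE : bhat mu = \sum_(q < Qb) theta_b q mu *: bhat_q q.
  rewrite /bhat affine_b // mulmx_sumr.
  by apply: eq_bigr => q _; rewrite -scalemxAr.
have proj_Ahat_q q : Q *m Q^T *m Ahat_q q = Ahat_q q.
  move: q; apply: hcat_inj; rewrite -mul_hcat.
  by move: (pivoted_QR_proj QR_B); rewrite mul_mx_row => /eq_row_mx[].
have AhatQ : Ahat mu = Q *m Y mu.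
  rewrite AhatE mulmx_sumr; apply: eq_bigr => q _.
  by rewrite -scalemxAr mulmxA proj_Ahat_q.
have rank_Ahat : \rank (Ahat mu) = m.
  rewrite /Ahat eqmxMfull ?rank_orthonormal_cols //.
  by rewrite row_full_unit unitmx_mul (cholesky_unitmx G_chol) A_unit.
have rank_Y : \rank (Y mu) = m.
  apply/eqP; rewrite eqn_leq rank_leq_col /=.
  by rewrite -{1}rank_Ahat AhatQ mxrankM_maxr.
have QR_Ahat : economy_QR (Ahat mu) (Q *m Qt mu) (Rm mu).
  by rewrite AhatQ; apply: economy_QR_mull => //; exact: QR_Y.
have Rm_unit : Rm mu \in unitmx.
  rewrite -row_full_unit /row_full eqn_leq rank_leq_col /=.
  by have [_ _ QRY] := QR_Y _ mu_Par; rewrite -{1}rank_Y -QRY mxrankM_maxr.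
split=> //; split=> //.
- exact: rank_orthonormal_cols.
- by rewrite -rank_Y rank_leq_row.
- by move=> c; rewrite -bhatE; exact: least_squares_QR.
rewrite trmx_mul -!mulmxA; congr (_ *m (_ *m _)).
by rewrite mulmx_sumr; apply: eq_bigr => q _; rewrite -scalemxAr.
Qed.
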